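(* Let $1\le p\le n$, let $A$ be a real symmetric $n\times n$ matrix and let $0<\mu_1<\dots<\mu_p$ be pairwise distinct, strictly positive real numbers. Then $U=[\mathbf u_1,\dots,\mathbf u_p]\in St^n_p$ is a critical point of the Brockett cost function $G_B:St^n_p\to\mathbb R$, $G_B(U)=\sum_{i=1}^p\mu_i\mathbf u_i^TA\mathbf u_i$, if and only if every column vector of $U$ is an eigenvector of $A$.
   Context: $St_p^n=\{U\in\mathcal M_{n\times p}(\mathbb R)\mid U^TU=\mathbb I_p\}$ is the orthogonal Stiefel manifold; $\mathbf u_1,\dots,\mathbf u_p\in\mathbb R^n$ are the columns of $U$. *)

(* Defs.v *)
From mathcomp Require Import all_boot all_order all_algebra.
From mathcomp Require Import all_classical all_reals all_analysis.

Set Implicit Arguments.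
Unset Strict Implicit.
Unset Printing Implicit Defensive.

Import Order.TTheory GRing.Theory Num.Theory.
Import numFieldNormedType.Exports.
Local Open Scope classical_set_scope.
Local Open Scope ring_scope.

Section Defs.
Context {R : realType}.

Definition stiefel (n p : nat) : set 'M[R]_(n, p) :=
  [set U | U^T *m U = 1%:M].

Definition smooth_on {V : normedModType R} (I : set R) (c : R -> V) : Prop :=
  forall (k : nat) (t : R), I t -> derivable (derive1n k c) t 1.

(* Tangent vectors of M at U are the velocities at 0 of these curves; c is
   unconstrained outside ]-e, e[. *)
Definition smooth_curve_through {V : normedModType R} (M : set V) (U : V)
    (c : R -> V) : Prop :=
  c 0 = U /\
  exists2 e : R, 0 < e &
    smooth_on `](- e), e[%classic c /\
    (forall t : R, `](- e), e[%classic t -> M (c t)).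

(* U is a critical point of the restriction f|M : M -> R, for M an embedded
   submanifold of V: the differential of f|M at U vanishes on the velocity at 0
   of every smooth curve of M through U, i.e. d/dt f(c(t)) = 0 at t = 0.
   Only the values of f on M are involved. *)
Definition critical_point {V : normedModType R} (M : set V) (f : V -> R)
    (U : V) : Prop :=
  M U /\
  forall c : R -> V, smooth_curve_through M U c ->
    is_derive (0 : R) 1 (f \o c) 0.

(* The 1 x 1 matrix u_i^T A u_i is identified with its entry. *)
Definition brockett (n p : nat) (A : 'M[R]_n) (mu : 'I_p -> R)
    (U : 'M[R]_(n, p)) : R :=
  \sum_(i < p) mu i * ((col i U)^T *m A *m col i U) 0 0.

(* The library's eigenspaces consist of row vectors. *)
Definition eigenvector (n : nat) (A : 'M[R]_n) (u : 'cV[R]_n) : Prop :=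
  u != 0 /\ exists a : R, A *m u = a *: u.

End Defs.

Arguments stiefel R n p _ : clear implicits.

(* Main.v *)
Require Import Defs.
From mathcomp Require Import all_boot all_order all_algebra.
From mathcomp Require Import all_classical all_reals all_analysis.
From mathcomp Require Import ring lra.

Import Order.TTheory GRing.Theory Num.Theory.
Import numFieldNormedType.Exports.
Local Open Scope classical_set_scope.
Local Open Scope ring_scope.

(** Write D = diag(mu) and S = U D U^T, so that G_B(U) = tr (D U^T A U).
Differentiating along the rotations t |-> exp(t J) U, with J = E_ab - E_ba,
gives tr ((S A - A S) J); as S A - A S is skew, criticality forces S A = A S.
Then B = U^T A U commutes with D, whose entries are distinct, so B is diagonal,
and A U D = A S U = S A U = U D B = U B D yields A U = U B since D is invertible.
Conversely, if A U = U L with L diagonal, the derivative along a tangent vector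
V is tr (D L (V^T U + U^T V)), and V^T U + U^T V = 0. *)

(** * Differentiation of matrix-valued maps *)

Lemma is_derive_mxP {R : realFieldType} {V : normedModType R} {m n : nat}
    {M : V -> 'M[R]_(m, n)} {t v : V} {D : 'M[R]_(m, n)} :
  is_derive t v M D <->
  forall i j, is_derive t v (fun x => M x i j) (D i j).
Proof.
split=> [[dM <-] i j|dM].
  have /derivable_mxP dMij := dM.
  by split=> //; rewrite derive_mx// mxE.
have drv : derivable M t v by apply/derivable_mxP => i j; case: (dM i j).
split=> //; rewrite derive_mx//; apply/matrixP => i j.
by rewrite mxE; case: (dM i j).
Qed.

Lemma is_derive_trmx {R : realFieldType} {V : normedModType R} {m n : nat}
    {M : V -> 'M[R]_(m, n)} {t v : V} {D : 'M[R]_(m, n)} :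
  is_derive t v M D -> is_derive t v (fun x => (M x)^T) D^T.
Proof.
move=> /is_derive_mxP dM; apply/is_derive_mxP => i j.
by rewrite mxE; under eq_fun do rewrite mxE.
Qed.

Lemma is_derive_mulmx {R : realFieldType} {V : normedModType R} {m n p : nat}
    {M : V -> 'M[R]_(m, n)} {N : V -> 'M[R]_(n, p)} {t v : V}
    {dM : 'M[R]_(m, n)} {dN : 'M[R]_(n, p)} :
  is_derive t v M dM -> is_derive t v N dN ->
  is_derive t v (fun x => M x *m N x) (dM *m N t + M t *m dN).
Proof.
move=> /is_derive_mxP hM /is_derive_mxP hN; apply/is_derive_mxP => i j.
have -> : (fun x => (M x *m N x) i j) =
    \sum_(k < n) ((fun x => M x i k) * (fun x => N x k j)).
  by apply/funext => x; rewrite mxE fct_sumE.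
have -> : (dM *m N t + M t *m dN) i j =
    \sum_(k < n) (M t i k *: dN k j + N t k j *: dM i k).
  rewrite !mxE -big_split; apply: eq_bigr => k _ /=.
  by rewrite addrC [dM i k * _]mulrC.
by apply: is_derive_sum => k; exact: is_deriveM.
Qed.

Lemma is_derive_mxtrace {R : realFieldType} {V : normedModType R} {n : nat}
    {M : V -> 'M[R]_n} {t v : V} {D : 'M[R]_n} :
  is_derive t v M D -> is_derive t v (fun x => \tr (M x)) (\tr D).
Proof.
move=> /is_derive_mxP dM.
rewrite (_ : (fun x => \tr (M x)) = \sum_(i < n) (fun x => M x i i)).
  exact: is_derive_sum.
by apply/funext => x; rewrite fct_sumE.
Qed.

Lemma is_derive_trig_mx {R : realType} (m n : nat) (P Q S : 'M[R]_(m, n))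
    (t : R) :
  is_derive t 1 (fun x => P + cos x *: Q + sin x *: S)
    (cos t *: S + sin t *: - Q).
Proof.
apply/is_derive_mxP => i j.
under eq_fun do rewrite !mxE.
rewrite !mxE.
apply: is_derive_eq.
rewrite !scaler0 /GRing.scale/=; ring.
Qed.

(** Differentiating yields a map of the same shape, with coefficients [0], [S] and [- Q]; hence the
    induction on [k] generalizes [P], [Q] and [S]. *)
Lemma derivable_derive1n_trig_mx {R : realType} (m n k : nat)
    (P Q S : 'M[R]_(m, n)) (t : R) :
  derivable (derive1n k (fun x => P + cos x *: Q + sin x *: S)) t 1.
Proof.
elim: k P Q S => [|k IHk] P Q S; first by case: (is_derive_trig_mx _ _ P Q S t).
rewrite derive1Sn.
rewrite (_ : derive1 _ = fun x => 0 + cos x *: S + sin x *: - Q)//.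
apply/funext => x; rewrite derive1E add0r.
by case: (is_derive_trig_mx _ _ P Q S x).
Qed.

(** * The Brockett function as a trace, and tangent vectors of the Stiefel manifold *)

Lemma brockett_trace {R : realType} {n p : nat} (A : 'M[R]_n) (mu : 'I_p -> R)
    (X : 'M[R]_(n, p)) :
  brockett A mu X = \tr (diag_mx (\row_i mu i) *m (X^T *m A *m X)).
Proof.
apply: eq_bigr => i _; rewrite mul_diag_mx [RHS]mxE [X in _ = X * _]mxE.
congr (_ * _); rewrite mxE [RHS]mxE; apply: eq_bigr => k _.
rewrite [col i X k 0]mxE; congr (_ * _); rewrite mxE [RHS]mxE.
by apply: eq_bigr => l _; rewrite !mxE.
Qed.

Lemma is_derive_brockett {R : realType} {n p : nat} (A : 'M[R]_n)
    (mu : 'I_p -> R) (c : R -> 'M[R]_(n, p)) (t : R) (V : 'M[R]_(n, p)) :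
  is_derive t 1 c V ->
  is_derive t 1 (brockett A mu \o c)
    (\tr (diag_mx (\row_i mu i) *m (V^T *m A *m c t + (c t)^T *m A *m V))).
Proof.
move=> dc; rewrite (funext (fun x => brockett_trace A mu (c x) : (_ \o c) x = _)).
apply: is_derive_mxtrace.
have dct := is_derive_trmx dc.
have dctA := is_derive_mulmx dct (is_derive_cst A t (1 : R)).
have := is_derive_mulmx (is_derive_cst (diag_mx (\row_i mu i)) t (1 : R))
  (is_derive_mulmx dctA dc).
by rewrite mul0mx add0r mulmx0 addr0.
Qed.

(** The map [(c t)^T *m c t] is constant near 0; the product rule expresses its zero derivative. *)
Lemma stiefel_tangent {R : realType} {n p : nat} (c : R -> 'M[R]_(n, p))
    (V : 'M[R]_(n, p)) :
  (\forall t \near (0 : R), stiefel R n p (c t)) -> is_derive (0 : R) 1 c V ->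
  V^T *m c 0 + (c 0)^T *m V = 0.
Proof.
move=> cS dc.
have d1 := is_derive_mulmx (is_derive_trmx dc) dc.
have d2 : is_derive (0 : R) 1 (fun x => (c x)^T *m c x) 0.
  apply: near_eq_is_derive (is_derive_cst (1%:M : 'M[R]_p) (0 : R) 1).
  by apply: filterS cS => x ->.
by rewrite -(@derive_val _ _ _ _ _ _ _ d1) (@derive_val _ _ _ _ _ _ _ d2).
Qed.

(** * Rotations and the commutation of [S] with [A] *)

Lemma mxtrace_mul_delta {R : pzSemiRingType} {m n : nat} (M : 'M[R]_(m, n)) a b :
  \tr (M *m delta_mx a b) = M b a.
Proof.
rewrite /mxtrace (bigD1 b)//= [X in _ + X]big1 => [|i /negPf nib].
  rewrite addr0 mxE (bigD1 a)//= mxE !eqxx mulr1 big1 ?addr0// => k /negPf nka.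
  by rewrite mxE nka mulr0.
by rewrite mxE big1// => k _; rewrite mxE nib andbF mulr0.
Qed.

(* For [J] skew with [J^3 = -J], [1 + J^2 + cos t *: - J^2 + sin t *: J] is
   [exp (t J)]. *)
Lemma smooth_curve_rotation {R : realType} {n p : nat} (J : 'M[R]_n)
    (U : 'M[R]_(n, p)) :
  J^T = - J -> J *m J *m J = - J -> stiefel R n p U ->
  smooth_curve_through (stiefel R n p) U
    (fun t => (1%:M + J *m J) *m U + cos t *: - (J *m J *m U)
              + sin t *: (J *m U)).
Proof.
move=> JT J3 hU; split.
  by rewrite cos0 sin0 scale1r scale0r addr0 mulmxDl mul1mx addrK.
exists 1 => //; split=> [k t _|t _]; first exact: derivable_derive1n_trig_mx.
set K := J *m J in J3 *.
have JK : J *m K = - J by rewrite mulmxA.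
have KK : K *m K = - K by rewrite {2}/K mulmxA J3 mulNmx.
have KT : K^T = K by rewrite trmx_mul JT mulNmx mulmxN opprK.
set c := cos t; set s := sin t.
(* With the rotation factored out on the left of [U], it suffices that the rotation is
   orthogonal. *)
have -> : (1%:M + K) *m U + c *: - (K *m U) + s *: (J *m U) =
    (1%:M + (1 - c) *: K + s *: J) *m U.
  rewrite !mulmxDl -!scalemxAl mul1mx scalerN scalerBl scale1r.
  by rewrite addrA.
rewrite /stiefel/= trmx_mul mulmxA -[_ *m _ *m (_ + _)]mulmxA.
suff -> : (1%:M + (1 - c) *: K + s *: J)^T *m (1%:M + (1 - c) *: K + s *: J)
    = 1%:M by rewrite mulmx1.
rewrite !linearD/= !linearZ/= trmx1 KT JT.
rewrite !(mulmxDl, mulmxDr, mul1mx, mulmx1) -!scalemxAl.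
rewrite !mulNmx J3 JK KK -/K.
have cs : s ^+ 2 = 1 - c ^+ 2 by rewrite -(cos2Dsin2 t) [X in X - _]addrC addrK.
clearbody K; apply/matrixP => i j; rewrite !mxE.
(* The [J] terms cancel, and [K] has coefficient [2(1 - c) - (1 - c)^2 - s^2 = 1 - c^2 - s^2]. *)
rewrite [LHS](_ : _ = (i == j)%:R + K i j * (1 - c ^+ 2 - s ^+ 2)); last by ring.
by rewrite cs subrr mulr0 addr0.
Qed.

(** The trace is [N b a - N a b], which is [- 2 N a b] for skew [N]; diagonal entries equal their
    opposites. *)
Lemma skew_mx_eq0 {R : realFieldType} {n : nat} (N : 'M[R]_n) :
  N^T = - N ->
  (forall a b, a != b -> \tr (N *m (delta_mx a b - delta_mx b a)) = 0) ->
  N = 0.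
Proof.
move=> NT H; apply/matrixP => a b; rewrite mxE.
have /matrixP/(_ a b) := NT; rewrite !mxE => Nab.
have [E|ab] := eqVneq a b.
  by move: Nab; rewrite E => ?; lra.
by have := H a b ab; rewrite mulmxBr linearB/= !mxtrace_mul_delta Nab => ?; lra.
Qed.

Lemma critical_point_brockett_comm {R : realType} {n p : nat} (A : 'M[R]_n)
    (mu : 'I_p -> R) (U : 'M[R]_(n, p)) :
  A^T = A -> critical_point (stiefel R n p) (brockett A mu) U ->
  U *m diag_mx (\row_i mu i) *m U^T *m A =
  A *m (U *m diag_mx (\row_i mu i) *m U^T).
Proof.
move=> AT [hU crit]; set D := diag_mx _; set S := U *m D *m U^T.
have ST : S^T = S by rewrite !trmx_mul trmxK tr_diag_mx mulmxA.
apply/eqP; rewrite -subr_eq0; apply/eqP; apply: skew_mx_eq0 => [|a b ab].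
  by rewrite linearB/= (trmx_mul S) (trmx_mul A) ST AT opprB.
(* [J] generates the rotations of the coordinate plane (a, b): [- J *m J] is the projection onto
   that plane. *)
set J := delta_mx a b - delta_mx b a.
have JT : J^T = - J by rewrite linearB/= !trmx_delta opprB.
have J3 : J *m J *m J = - J.
  have ba : b != a by rewrite eq_sym.
  have JJ : J *m J = - delta_mx a a - delta_mx b b.
    rewrite mulmxBl !mulmxBr !mul_delta_mx (mul_delta_mx_0 _ _ _ ba).
    by rewrite (mul_delta_mx_0 _ _ _ ab) sub0r subr0.
  rewrite JJ mulmxBl mulNmx !mulmxBr !mul_delta_mx (mul_delta_mx_0 _ _ _ ba).
  by rewrite (mul_delta_mx_0 _ _ _ ab) subr0 sub0r opprK opprB addrC.
have dc := is_derive_trig_mx _ _ ((1%:M + J *m J) *m U) (- (J *m J *m U)) (J *m U) 0.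
have cC := smooth_curve_rotation J U JT J3 hU.
have := is_derive_brockett A mu _ _ _ dc.
have d0 := crit _ cC; case: (cC) => -> _ d1.
(* The derivative at 0 is zero by criticality and a trace by the product rule; the curve has
   velocity [J *m U] there. *)
move: (@derive_val _ _ _ _ _ _ _ d0); rewrite (@derive_val _ _ _ _ _ _ _ d1).
rewrite cos0 sin0 scale1r scale0r addr0 trmx_mul JT -/D => E.
rewrite -{}[RHS]E; clearbody J.
(* The two traces agree term by term, up to cyclic permutation of the factors. *)
rewrite mulmxBl linearB/= mulmxDr linearD/= addrC.
congr (_ + _).
  rewrite !(mulmxN, mulNmx) linearN/=; congr (- _).
  by rewrite !mulmxA [RHS]mxtrace_mulC !mulmxA [RHS]mxtrace_mulC !mulmxA.
by rewrite !mulmxA [RHS]mxtrace_mulC !mulmxA.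
Qed.

(** * Eigenvector columns, diagonal matrices and the equivalence *)

Lemma eigenvectors_diag {R : realType} {n p : nat} (A : 'M[R]_n)
    (U : 'M[R]_(n, p)) : stiefel R n p U ->
  (forall i, eigenvector A (col i U)) <->
  exists l : 'rV_p, A *m U = U *m diag_mx l.
Proof.
move=> hU.
have Acol i : A *m col i U = col i (A *m U) by rewrite !colE mulmxA.
split=> [H|[l Al] i].
  have /choice[l Al] : forall i, exists a, A *m col i U = a *: col i U.
    by move=> i; case: (H i).
  exists (\row_i l i); apply/matrixP => k i.
  have /matrixP/(_ k 0) := Al i.
  by rewrite Acol mul_mx_diag !mxE mulrC.
split; last first.
  exists (l 0 i); rewrite Acol Al mul_mx_diag.
  by apply/matrixP => k j; rewrite !mxE mulrC.
(* A zero column would make the (i, i) entry of [U^T *m U] vanish, whereas it is 1. *)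
apply/eqP => Ui0; move/matrixP: hU => /(_ i i); rewrite !mxE eqxx big1 => [/esym/eqP|k _].
  by rewrite oner_eq0.
by have /matrixP/(_ k 0) := Ui0; rewrite !mxE => ->; rewrite mulr0.
Qed.

(** Entry (i, j) of the commutation relation reads [(d_i - d_j) B_ij = 0]. *)
Lemma mulmx_diag_comm {R : idomainType} {p : nat} (d : 'rV[R]_p) (B : 'M[R]_p) :
  (forall i j, i != j -> d 0 i != d 0 j) -> diag_mx d *m B = B *m diag_mx d ->
  B = diag_mx (\row_i B i i).
Proof.
move=> dI /matrixP dB; apply/matrixP => i j; rewrite !mxE.
have [->|ij] := eqVneq i j; first by rewrite mulr1n.
have := dB i j; rewrite mul_diag_mx mul_mx_diag !mxE [RHS]mulrC => /eqP.
rewrite -subr_eq0 -mulrBl mulf_eq0 subr_eq0 (negPf (dI _ _ ij)) => /eqP ->.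
by rewrite mulr0n.
Qed.

Theorem mainTheorem10 (R : realType) (n p : nat)
    (hp : (1 <= p)%N) (hpn : (p <= n)%N)
    (A : 'M[R]_n) (hA : A^T = A)
    (mu : 'I_p -> R)
    (hmu_pos : forall i : 'I_p, 0 < mu i)
    (hmu_incr : forall i j : 'I_p, (i < j)%N -> mu i < mu j)
    (U : 'M[R]_(n, p)) (hU : stiefel R n p U) :
  critical_point (stiefel R n p) (brockett A mu) U <->
  (forall i : 'I_p, eigenvector A (col i U)).
Proof.
have muI i j : i != j -> (\row_i mu i : 'rV_p) 0 i != (\row_i mu i : 'rV_p) 0 j.
  rewrite !mxE neq_lt => /orP[] ij.
    by rewrite (lt_eqF (hmu_incr _ _ ij)).
  by rewrite (gt_eqF (hmu_incr _ _ ij)).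
rewrite (eigenvectors_diag A U hU); split=> [crit|[l Al]].
  have SA := critical_point_brockett_comm A mu U hA crit.
  set d := \row_i mu i in muI SA; set D := diag_mx d in SA.
  pose B := U^T *m A *m U.
  (* Multiply [SA] by [U^T] on the left and [U] on the right, and cancel [U^T *m U]. *)
  have DB : D *m B = B *m D.
    have := congr1 (fun M => U^T *m M *m U) SA.
    rewrite /= !mulmxA hU mul1mx -!mulmxA hU mulmx1 => DB.
    by rewrite /B !mulmxA in DB *.
  have [l Bl] : exists l, B = diag_mx l.
    by exists (\row_i B i i); exact: mulmx_diag_comm DB.
  (* Positivity of the [mu i] makes [D] invertible. *)
  have D1 : D *m diag_mx (\row_i (mu i)^-1) = 1%:M.
    rewrite mulmx_diag -diag_const_mx; congr diag_mx.
    by apply/rowP => i; rewrite !mxE divff// gt_eqF.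
  exists l.
  have AUD : A *m U *m D = U *m B *m D.
    by rewrite -(mulmxA U) -DB /B !mulmxA SA -!mulmxA hU mulmx1.
  have := congr1 (fun M => M *m diag_mx (\row_i (mu i)^-1)) AUD.
  by clearbody B; rewrite /= -!mulmxA D1 !mulmx1 -Bl.
split=> // c [c0 [e e0 [cs cS]]].
have dc : is_derive (0 : R) 1 c ('D_1 c 0).
  by apply: DeriveDef => //; apply: (cs 0%N); rewrite /= in_itv/= oppr_lt0 e0.
have tg : ('D_1 c 0)^T *m c 0 + (c 0)^T *m 'D_1 c 0 = 0.
  apply: stiefel_tangent dc; near=> t; apply: cS; near: t.
  by apply: near_in_itvoo; rewrite in_itv/= oppr_lt0 e0.
apply: is_derive_eq (is_derive_brockett A mu _ _ _ dc) _.
move: tg; rewrite c0; set V := 'D_1 c 0 => tg.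
(* The transpose of [Al], as [A] is symmetric. *)
have UA : U^T *m A = diag_mx l *m U^T.
  by apply: trmx_inj; rewrite !trmx_mul trmxK hA Al tr_diag_mx.
(* Cyclicity of the trace and commuting diagonal matrices bring out the common factor in front of
   [tg]. *)
rewrite -[V^T *m A *m U]mulmxA Al UA mulmxDr linearD/= !mulmxA mxtrace_mulC !mulmxA.
rewrite [diag_mx l *m _]diag_mxC.
by rewrite -!mulmxA -linearD/= -!mulmxDr tg !mulmx0 linear0.
Unshelve. all: by end_near.
Qed.
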